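(* For any algebra $A\in\mathcal{V}$ such that $K(A)$ is closed under the commutator operation, the following are equivalent: (1) $A$ is a $PF$-algebra; (2) $A$ is a semiprime $mp$-algebra.
   Context: $\mathcal{V}$ is a fixed congruence-modular variety of algebras (of a finite signature) that is semidegenerate: no nontrivial algebra in $\mathcal{V}$ has one-element subalgebras (equivalently, $\nabla_A$ is compact in $Con(A)$ for every $A\in\mathcal{V}$). For $A\in\mathcal{V}$, $Con(A)$ is the complete lattice of congruences of $A$, with least element $\Delta_A$ and greatest element $\nabla_A$; $K(A)$ is the set of compact (= finitely generated) congruences and $PCon(A)$ the set of principal congruences. Commutator: $[\cdot,\cdot]=[\cdot,\cdot]_A$ is the (modular) commutator, i.e. the greatest operation on the congruence lattices of members of $\mathcal{V}$ such that for every surjective morphism $f:A\to B$ in $\mathcal{V}$ and all $\alpha,\beta\in Con(A)$: $[\alpha,\beta]_A\subseteq\alpha\cap\beta$ and $[\alpha,\beta]_A\vee Ker(f)=f^{-1}([f(\alpha\vee Ker(f)),f(\beta\vee Ker(f))]_B)$. Put $\alpha^{\perp}=\bigvee\{\gamma\in Con(A)\mid[\alpha,\gamma]=\Delta_A\}$. $\phi\in Con(A)\setminus\{\nabla_A\}$ is prime if $[\alpha,\beta]\subseteq\phi$ implies $\alpha\subseteq\phi$ or $\beta\subseteq\phi$ (for $\alpha,\beta\in Con(A)$); $Spec(A)$ is the set of prime congruences; $A$ is semiprime if $\bigcap Spec(A)=\Delta_A$. $A$ is an $mp$-algebra if every prime congruence of $A$ contains a unique minimal prime congruence. A congruence $\theta$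 is pure if for every $\alpha\in K(A)$ with $\alpha\subseteq\theta$ one has $\theta\vee\alpha^{\perp}=\nabla_A$. $A$ is a $PF$-algebra if $\alpha^{\perp}$ is a pure congruence for all $\alpha\in PCon(A)$. *)

(* Defs.v *)
From mathcomp Require Import all_boot.
From mathcomp Require Import boolp classical_sets functions cardinality.

Set Implicit Arguments.
Unset Strict Implicit.
Unset Printing Implicit Defensive.

Local Open Scope classical_set_scope.

(** Algebras over a finite signature; carriers are nonempty, as is usual in
    universal algebra. *)

Record signature := Signature { symbol : finType; arity : symbol -> nat }.

Record algebra (sg : signature) := Algebra {
  carrier :> Type;
  opn : forall o : symbol sg, ('I_(arity o) -> carrier) -> carrier;
  carrier_inh : inhabited carrier }.

Record hom (sg : signature) (A B : algebra sg) := Hom {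
  hom_fun :> A -> B;
  hom_opn : forall (o : symbol sg) (xs : 'I_(arity o) -> A),
    hom_fun (opn xs) = opn (fun i => hom_fun (xs i)) }.

Definition surj_hom (sg : signature) (A B : algebra sg) (f : hom A B) : Prop :=
  forall y : B, exists x : A, f x = y.

Definition subuniverse (sg : signature) (A : algebra sg) (S : set A) : Prop :=
  forall (o : symbol sg) (xs : 'I_(arity o) -> A),
    (forall i, S (xs i)) -> S (opn xs).

Section Subalgebra.
Context (sg : signature) (A : algebra sg) (S : set A).
Hypotheses (subS : subuniverse S) (S0 : exists x, S x).

Definition sub_opn (o : symbol sg) (xs : 'I_(arity o) -> {x : A | S x}) :
  {x : A | S x} :=
  exist _ _ (subS (fun i => proj2_sig (xs i))).

Lemma sub_inh : inhabited {x : A | S x}.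
Proof. by case: S0 => x Sx; split; exists x. Qed.

Definition subalgebra : algebra sg := Algebra sub_opn sub_inh.
End Subalgebra.

Section Product.
Context (sg : signature) (I : Type) (F : I -> algebra sg).

Definition prod_opn (o : symbol sg) (xs : 'I_(arity o) -> forall i, F i) :
  forall i, F i :=
  fun i => opn (fun k => xs k i).

Lemma prod_inh : inhabited (forall i, F i).
Proof.
have h i : {x : F i | True}.
  by apply: cid; case: (carrier_inh (F i)) => x; exists x.
by split=> i; exact: (proj1_sig (h i)).
Qed.

Definition prod_algebra : algebra sg := Algebra prod_opn prod_inh.
End Product.

Definition variety (sg : signature) (V : set (algebra sg)) : Prop :=
  [/\ forall (A B : algebra sg) (f : hom A B), surj_hom f -> V A -> V B,
      forall (A : algebra sg) (S : set A) (hS : subuniverse S)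
        (S0 : exists x, S x), V A -> V (subalgebra hS S0)
    & forall (I : Type) (F : I -> algebra sg),
        (forall i, V (F i)) -> V (prod_algebra F)].

Definition semidegenerate (sg : signature) (V : set (algebra sg)) : Prop :=
  forall A : algebra sg, V A -> (exists x y : A, x <> y) ->
    ~ exists a : A, subuniverse [set a].

Record congruence (sg : signature) (A : algebra sg) := Congruence {
  con_rel :> A -> A -> Prop;
  con_refl : forall x, con_rel x x;
  con_sym : forall x y, con_rel x y -> con_rel y x;
  con_trans : forall x y z, con_rel x y -> con_rel y z -> con_rel x z;
  con_opn : forall (o : symbol sg) (xs ys : 'I_(arity o) -> A),
    (forall i, con_rel (xs i) (ys i)) -> con_rel (opn xs) (opn ys) }.

Definition cle (sg : signature) (A : algebra sg) (a b : congruence A) : Prop :=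
  forall x y, a x y -> b x y.

Declare Scope con_scope.
Delimit Scope con_scope with con.
Notation "a <=c b" := (cle a b) (at level 70, no associativity) : con_scope.
Local Open Scope con_scope.

Lemma con_ext (sg : signature) (A : algebra sg) (a b : congruence A) :
  a <=c b -> b <=c a -> a = b.
Proof.
case: a b => [r r1 r2 r3 r4] [s s1 s2 s3 s4] /= rs sr.
have e : r = s.
  by apply/funext => x; apply/funext => y; apply/propext; split;
     [exact: rs | exact: sr].
by subst s; congr Congruence; exact: Prop_irrelevance.
Qed.

Section CongruenceLattice.
Context (sg : signature) (A : algebra sg).

Definition cdelta : congruence A.
Proof.
refine (@Congruence sg A (fun x y => x = y) _ _ _ _) => //.
- by move=> x y z -> ->.
- by move=> o xs ys /funext ->.
Defined.

Definition cnabla : congruence A.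
Proof. exact: (@Congruence sg A (fun _ _ => True)). Defined.

Definition cInf (S : set (congruence A)) : congruence A.
Proof.
refine (@Congruence sg A (fun x y => forall t, S t -> t x y) _ _ _ _).
- by move=> x t _; exact: con_refl.
- by move=> x y h t St; apply: con_sym; exact: h.
- by move=> x y z h k t St; exact: con_trans (h t St) (k t St).
- by move=> o xs ys h t St; apply: con_opn => i; exact: h.
Defined.

Definition cSup (S : set (congruence A)) : congruence A :=
  cInf [set t | forall s, S s -> s <=c t].

Definition cmeet (a b : congruence A) : congruence A := cInf [set a; b].
Definition cjoin (a b : congruence A) : congruence A := cSup [set a; b].

Definition cprincipal (x y : A) : congruence A :=
  cInf [set t : congruence A | t x y].

Definition PCon : set (congruence A) :=
  [set a | exists x y, a = cprincipal x y].

Definition KCon : set (congruence A) :=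
  [set a | forall S : set (congruence A), a <=c cSup S ->
     exists2 F : set (congruence A), finite_set F /\ F `<=` S & a <=c cSup F].

Lemma cjoin_ler (a b : congruence A) : b <=c cjoin a b.
Proof. by move=> x y bxy t /= /(_ b (or_intror erefl)); exact. Qed.

End CongruenceLattice.

Definition congruence_modular (sg : signature) (V : set (algebra sg)) : Prop :=
  forall A : algebra sg, V A -> forall a b c : congruence A, a <=c c ->
    cjoin a (cmeet b c) = cmeet (cjoin a b) c.

Section Transport.
Context (sg : signature) (A B : algebra sg) (f : hom A B).

Definition cpreim (b : congruence B) : congruence A.
Proof.
refine (@Congruence sg A (fun x y => b (f x) (f y)) _ _ _ _).
- by move=> x; exact: con_refl.
- by move=> x y; exact: con_sym.
- by move=> x y z; exact: con_trans.
- by move=> o xs ys h; rewrite !hom_opn; exact: con_opn.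
Defined.

Definition cker : congruence A := cpreim (cdelta B).

Definition cimage (fsurj : surj_hom f) (a : congruence A) (ka : cker <=c a) :
  congruence B.
Proof.
refine (@Congruence sg B
  (fun u v => exists x y, [/\ a x y, f x = u & f y = v]) _ _ _ _).
- by move=> u; have [x fx] := fsurj u; exists x, x; split=> //; exact: con_refl.
- by move=> u v [x [y [axy fx fy]]]; exists y, x; split=> //; exact: con_sym.
- move=> u v w [x [y [axy fx fy]]] [y' [z [ayz fy' fz]]].
  exists x, z; split=> //; apply: con_trans axy _; apply: con_trans _ ayz.
  by apply: ka; rewrite /= fy fy'.
- move=> o us vs h.
  have [xs hx] := choice h.
  have [ys hy] := choice hx.
  exists (opn xs), (opn ys); split.
  + by apply: con_opn => i; case: (hy i).
  + by rewrite hom_opn; congr opn; apply/funext => i; case: (hy i).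
  + by rewrite hom_opn; congr opn; apply/funext => i; case: (hy i).
Defined.

End Transport.

(** An operation on the congruence lattices is given on all algebras of the
    signature, but only its values on members of [V] are ever constrained or
    compared.  In [commutator_axioms], the congruence whose image is taken by
    [cimage] is carried by the proof argument: the two images are those of
    [cjoin a (cker f)] and [cjoin b (cker f)]. *)

Definition con_operation (sg : signature) : Type :=
  forall A : algebra sg, congruence A -> congruence A -> congruence A.

Definition commutator_axioms (sg : signature) (V : set (algebra sg))
    (C : con_operation sg) : Prop :=
  (forall A : algebra sg, V A -> forall a b : congruence A,
     C A a b <=c cmeet a b) /\
  (forall (A B : algebra sg) (f : hom A B) (fsurj : surj_hom f), V A -> V B ->
     forall a b : congruence A,
     cjoin (C A a b) (cker f) =
     cpreim f (C B (cimage fsurj (@cjoin_ler sg A a (cker f)))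
                   (cimage fsurj (@cjoin_ler sg A b (cker f))))).

Definition is_commutator (sg : signature) (V : set (algebra sg))
    (C : con_operation sg) : Prop :=
  commutator_axioms V C /\
  forall D : con_operation sg, commutator_axioms V D ->
    forall A : algebra sg, V A -> forall a b : congruence A,
      D A a b <=c C A a b.

(** The greatest such operation exists: it is the pointwise join of all of
    them. *)
Lemma commutator_exists (sg : signature) (V : set (algebra sg)) :
  exists C : con_operation sg, is_commutator V C.
Proof.
pose C : con_operation sg := fun A a b =>
  cSup [set c | exists2 D, commutator_axioms V D & c = D A a b].
have Cge D : commutator_axioms V D -> forall A (a b : congruence A),
    D A a b <=c C A a b.
  by move=> hD A a b x y Dxy t; apply; [exists D|].
have Cle A (a b t : congruence A) :
    (forall D, commutator_axioms V D -> D A a b <=c t) -> C A a b <=c t.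
  by move=> h x y; apply=> _ [D hD ->]; exact: h.
have hDelta : commutator_axioms V (fun A _ _ => cdelta A).
  split=> [A _ a b x y <- t _|A B f fs _ _ a b]; first exact: con_refl.
  apply: con_ext => x y; last by move=> h t; apply; [right|].
  apply=> s [->|->] //.
  by move=> u v <- /=.
exists C; split; last by move=> D hD A _; exact: Cge.
split=> [A VA a b|A B f fs VA VB a b].
  by apply: Cle => D [h _]; exact: h.
set a' := cimage _ _; set b' := cimage _ _.
apply: con_ext => x y.
  apply=> s [->|->].
    apply: Cle => D hD u v Duv; apply: (Cge D hD B).
    rewrite -[D B a' b' (f u) (f v)]/(cpreim f (D B a' b') u v).
    rewrite -(hD.2 A B f fs VA VB a b) => t /=; apply; first by left.
    exact: Duv.
  move=> u v kuv; rewrite -[cpreim _ _ u v]/(C B a' b' (f u) (f v)).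
  by rewrite (kuv : f u = f v); exact: con_refl.
set J := cjoin _ _ => Cxy.
have kJ : cker f <=c J by exact: cjoin_ler.
have : C B a' b' <=c cimage fs kJ.
  apply: Cle => D hD u v Duv.
  have [p pu] := fs u; have [q qv] := fs v.
  exists p, q; split=> //.
  have : cpreim f (D B a' b') p q by rewrite /= pu qv.
  rewrite /a' /b' -(hD.2 A B f fs VA VB a b); apply=> s [->|-> //].
  move=> w z Dwz t; apply; first by left.
  exact: Cge Dwz.
move=> /(_ _ _ Cxy) [p [q [Jpq fp fq]]].
apply: con_trans (con_trans Jpq _).
  by apply: kJ; rewrite /= fp.
by apply: kJ.
Qed.

Section Notions.
Context (sg : signature) (C : con_operation sg) (A : algebra sg).

Definition cperp (a : congruence A) : congruence A :=
  cSup [set c | C a c = cdelta A].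

Definition Spec : set (congruence A) :=
  [set p | p <> cnabla A /\
     forall a b : congruence A, C a b <=c p -> a <=c p \/ b <=c p].

Definition MinSpec : set (congruence A) :=
  [set m | Spec m /\ forall p, Spec p -> p <=c m -> p = m].

Definition semiprime : Prop := cInf Spec = cdelta A.

Definition mp_algebra : Prop :=
  forall p, Spec p -> exists! m, MinSpec m /\ m <=c p.

Definition pure (t : congruence A) : Prop :=
  forall a, KCon a -> a <=c t -> cjoin t (cperp a) = cnabla A.

Definition PF_algebra : Prop := forall a, PCon a -> pure (cperp a).

End Notions.

(* Main.v *)
Require Import Defs.
From mathcomp Require Import all_boot.
From mathcomp Require Import boolp classical_sets cardinality.

Set Implicit Arguments.
Unset Strict Implicit.
Unset Printing Implicit Defensive.

Local Open Scope classical_set_scope.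
Local Open Scope con_scope.

(** The argument has two halves.

    The commutator is only given as the greatest operation subject to two
    axioms, and everything needed about it is extracted by computing it.  Regard
    a congruence [a] as a subalgebra of the square of the algebra, and let
    [diagc a b] be the congruence of that subalgebra generated by the pairs of
    diagonal elements coming from [b].  Let [tcomm a b] be the least congruence
    relating [y] and [z] whenever [(x, y)] and [(x, z)] are [diagc a b]-related.
    Every operation satisfying the axioms lies below [tcomm], because inside the
    square [a] and [b] are the images of the kernel of the first projection and
    of [diagc a b], whose commutator lies in their meet.  Conversely [tcomm]
    satisfies the axioms.  The hard part is its behaviour under homomorphisms,
    which reduces to symmetry and complete additivity.  Both follow from
    modularity in the form of the shifting lemma: if [tcomm a b] lies below [d],
    then the matrices collected in [diagc a b] transfer membership in [d] from
    one side to the opposite side, in both directions ([tcomm_transfer_rows],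
    [tcomm_transfer_cols]), and this survives chains of matrices ([cgen_ind]).
    Hence the commutator is [tcomm] ([commutator_tcomm]), so it is symmetric and
    completely additive.  Semidegeneracy enters in [semidegenerate_total]: a
    congruence having a class that is a subalgebra is total.  Applied to the
    diagonal it gives [tcomm a nabla = a]; applied to a congruence making one
    element idempotent it shows, the signature being finite, that the greatest
    congruence is compact.

    What remains is ideal theory in an algebraic lattice with such a
    multiplication, compact elements being closed under it.  The key is
    [perp_not_below]: in a semiprime algebra, if a compact [a] lies below every
    prime contained in the prime [p], then its annihilator is not below [p].
    For a minimal prime [p] the assumption just says that [a] lies below [p], so
    that in a PF-algebra two minimal primes inside one prime would contain one
    each of two comaximal annihilators.  If, however, a prime [p] contains a
    unique minimal prime [m], the assumption says that [a] lies below [m]; when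
    [C a b = 0], one of [a] and [b] does, so no prime contains both
    annihilators.  Finally, a PF-algebra has no nonzero congruence of square
    zero: purity makes the annihilator of a principal congruence of square zero
    the greatest congruence.  Hence it is semiprime. *)

(** * The congruence lattice *)

Section Lattice.
Context (sg : signature) (A : algebra sg).
Implicit Types (a b c t : congruence A) (S : set (congruence A)).

Lemma cle_refl a : a <=c a. Proof. by move=> x y. Qed.

Lemma cle_trans b a c : a <=c b -> b <=c c -> a <=c c.
Proof. by move=> ab bc x y axy; exact/bc/ab. Qed.

Lemma cle_delta a : cdelta A <=c a.
Proof. by move=> x y /= ->; exact: con_refl. Qed.

Lemma cSup_ub S s : S s -> s <=c cSup S.
Proof. by move=> Ss x y sxy t /(_ s Ss) h; exact: h. Qed.

Lemma cSup_lub S t : (forall s, S s -> s <=c t) -> cSup S <=c t.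
Proof. by move=> h x y hxy; apply: hxy. Qed.

Lemma cjoin_lel a b : a <=c cjoin a b.
Proof. by apply: cSup_ub; left. Qed.

Lemma cjoin_lub a b t : a <=c t -> b <=c t -> cjoin a b <=c t.
Proof. by move=> at_ bt; apply: cSup_lub => _ [->|->]. Qed.

Lemma cjoin_idr a b : a <=c b -> cjoin a b = b.
Proof. by move=> ab; apply: con_ext; [exact: cjoin_lub | exact: cjoin_ler]. Qed.

Lemma cmeet_lel a b : cmeet a b <=c a.
Proof. by move=> x y; apply; left. Qed.

Lemma cmeet_ler a b : cmeet a b <=c b.
Proof. by move=> x y; apply; right. Qed.

Lemma cle_meet a b t : t <=c a -> t <=c b -> t <=c cmeet a b.
Proof. by move=> ta tb x y txy _ [->|->]; [exact: ta | exact: tb]. Qed.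

Lemma cprincipal_le a x y : a x y -> cprincipal x y <=c a.
Proof. by move=> axy u v h; apply: h. Qed.

Lemma cprincipal_refl (x y : A) : cprincipal x y x y.
Proof. by move=> t. Qed.

Lemma cleNP a b : ~ a <=c b -> exists x y, a x y /\ ~ b x y.
Proof.
move=> nab; apply: contrapT => h; apply: nab => x y axy.
by apply: contrapT => nb; apply: h; exists x, y.
Qed.

Definition cgen (R : A -> A -> Prop) : congruence A :=
  cInf [set t : congruence A | forall x y, R x y -> t x y].

Lemma cgen_sub R x y : R x y -> cgen R x y.
Proof. by move=> Rxy t h; exact: h. Qed.

Lemma cgen_le (R : A -> A -> Prop) t :
  (forall x y, R x y -> t x y) -> cgen R <=c t.
Proof. by move=> h x y hxy; apply: hxy. Qed.

Definition translation_stable (R : A -> A -> Prop) : Prop :=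
  forall (o : symbol sg) (xs ys : 'I_(arity o) -> A) k,
    (forall i, i != k -> xs i = ys i) -> R (xs k) (ys k) ->
    R (opn xs) (opn ys).

(** The congruence generated by a symmetric relation that is stable under
    changing a single argument is its reflexive and transitive closure; phrased
    as an induction principle, this says that a set closed under [R]-steps is
    closed under [cgen R].  A change of all the arguments of an operation is
    performed one argument at a time, which is where finiteness of the arities
    enters. *)
Lemma cgen_ind (R : A -> A -> Prop) (P : A -> Prop) :
  (forall x y, R x y -> R y x) -> translation_stable R ->
  (forall x y, R x y -> P x -> P y) ->
  forall x y, cgen R x y -> P x -> P y.
Proof.
move=> Rs Rt RP.
pose E x y := forall Q : A -> Prop, (forall u v, R u v -> Q u -> Q v) ->
  Q x -> Q y.
have Er x : E x x by [].
have Et x y z : E x y -> E y z -> E x z.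
  by move=> xy yz Q QR /(xy _ QR) /(yz _ QR).
have Es x y : E x y -> E y x.
  move=> xy; apply: (xy (fun z => E z x)) => // u v Ruv Eux.
  by apply: (Et _ _ _ _ Eux) => Q QR; apply: QR; exact: Rs.
have Eo (o : symbol sg) (xs ys : 'I_(arity o) -> A) :
    (forall i, E (xs i) (ys i)) -> E (opn xs) (opn ys).
  move=> h.
  pose zs k := fun i : 'I_(arity o) => if (i < k)%N then ys i else xs i.
  suff H k : (k <= arity o)%N -> E (opn (zs 0%N)) (opn (zs k)).
    have -> : opn xs = opn (zs 0%N) by congr opn; apply/funext.
    have -> : opn ys = opn (zs (arity o)).
      by congr opn; apply/funext => i; rewrite /zs ltn_ord.
    exact: H.
  elim: k => [//|k IH] kn; apply: (Et _ _ _ (IH (ltnW kn))).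
  pose k' := Ordinal kn.
  pose ws u := fun i : 'I_(arity o) => if i == k' then u else zs k i.
  have -> : opn (zs k) = opn (ws (xs k')).
    congr opn; apply/funext => i; rewrite /ws; case: eqP => // ->.
    by rewrite /zs ltnn.
  have -> : opn (zs k.+1) = opn (ws (ys k')).
    congr opn; apply/funext => i; rewrite /ws /zs.
    case: eqP => [->|/eqP nik] /=; first by rewrite ltnSn.
    by rewrite ltnS leq_eqVlt -val_eqE /= in nik *; rewrite (negbTE nik).
  apply: (h k' (fun u => E (opn (ws (xs k'))) (opn (ws u)))) => // u v Ruv Eu.
  apply: (Et _ _ _ Eu) => Q QR; apply: QR; apply: (Rt _ _ _ k').
    by move=> i /negbTE nik; rewrite /ws nik.
  by rewrite /ws eqxx.
pose T := @Congruence sg A E Er Es Et Eo.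
move=> x y xy; apply: (cgen_le (t := T) _ xy) => // u v Ruv Q QR.
exact: QR.
Qed.

End Lattice.

Arguments cle_trans {sg A} b {a c}.
Arguments cprincipal_refl {sg A} x y.

(** Modularity as a statement about rectangles: two horizontal [s]-sides, two
    vertical [r]-sides, one of which lies in [t]. *)
Lemma shifting (sg : signature) (V : set (algebra sg)) (A : algebra sg)
    (r s t : congruence A) (x y z w : A) :
  congruence_modular V -> V A -> cmeet r s <=c t ->
  s x y -> s z w -> r x z -> t x z -> r y w -> t y w.
Proof.
move=> Vmod VA rst sxy szw rxz txz ryw.
have := Vmod A VA (cmeet r t) s r (@cmeet_lel _ _ r t).
set L := cjoin _ _; set M := cmeet _ _ => LM.
have : M y w.
  move=> _ [->|-> //].
  have rt : cmeet r t x z by move=> _ [->|->].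
  have J1 := cjoin_lel (b := s) rt.
  have J2 := cjoin_ler (a := cmeet r t) (con_sym sxy).
  have J3 := cjoin_ler (a := cmeet r t) szw.
  exact: con_trans (con_trans J2 J1) J3.
rewrite -LM; apply: cjoin_lub.
  exact: cmeet_ler.
by apply: cle_trans rst; apply: cle_meet; [exact: cmeet_ler|exact: cmeet_lel].
Qed.

(** * Homomorphisms and quotients *)

Section Homomorphisms.
Context (sg : signature) (A B : algebra sg) (f : hom A B).

Lemma cpreim_le (b b' : congruence B) :
  b <=c b' -> cpreim f b <=c cpreim f b'.
Proof. by move=> bb x y /bb. Qed.

Lemma cker_preim (b : congruence B) : cker f <=c cpreim f b.
Proof. by move=> x y /= ->; exact: con_refl. Qed.

Context (fs : surj_hom f).

Lemma cpreim_image (a : congruence A) (ka : cker f <=c a) :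
  cpreim f (cimage fs ka) = a.
Proof.
apply: con_ext => x y; last by move=> axy; exists x, y.
move=> [u [v [auv fu fv]]]; apply: con_trans (con_trans _ auv) _.
  by apply: ka; rewrite /= fu.
by apply: ka.
Qed.

Lemma cpreim_inj (b b' : congruence B) : cpreim f b = cpreim f b' -> b = b'.
Proof.
move=> e; apply: con_ext => u v; have [x <-] := fs u; have [y <-] := fs v.
  by rewrite -[b _ _]/(cpreim f b x y) e.
by rewrite -[b' _ _]/(cpreim f b' x y) -e.
Qed.

End Homomorphisms.

Section Quotient.
Context (sg : signature) (A : algebra sg) (t : congruence A).

Definition quo_type := {P : A -> Prop | exists x, P = t x}.

Definition quo_class (x : A) : quo_type := exist _ (t x) (ex_intro _ x erefl).

Lemma quo_classE x y : quo_class x = quo_class y <-> t x y.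
Proof.
split=> [[e]|txy]; first by rewrite e; exact: con_refl.
apply: eq_exist; apply/funext => z; apply/propext; split;
  apply: con_trans => //.
exact: con_sym.
Qed.

Definition quo_repr (P : quo_type) : A := proj1_sig (cid (proj2_sig P)).

Lemma quo_reprK P : quo_class (quo_repr P) = P.
Proof.
rewrite /quo_repr; case: P => P hP /=; apply: eq_exist.
by case: cid => x /= ->.
Qed.

Definition quo_opn (o : symbol sg) (xs : 'I_(arity o) -> quo_type) : quo_type :=
  quo_class (opn (fun i => quo_repr (xs i))).

Lemma quo_inh : inhabited quo_type.
Proof. by case: (carrier_inh A) => x; split; exact: quo_class x. Qed.

Definition quotient : algebra sg := Algebra quo_opn quo_inh.

Lemma quo_class_opn (o : symbol sg) (xs : 'I_(arity o) -> A) :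
  quo_class (opn xs) = opn (fun i => quo_class (xs i) : quotient).
Proof.
apply/quo_classE; apply: con_opn => i.
by apply: con_sym; apply/quo_classE; exact: quo_reprK.
Qed.

Definition quo_hom : hom A quotient :=
  @Hom sg A quotient quo_class quo_class_opn.

Lemma quo_hom_surj : surj_hom quo_hom.
Proof. by move=> P; exists (quo_repr P); exact: quo_reprK. Qed.

End Quotient.

(** If the class of [d] is a subalgebra, it becomes a one-element subalgebra of
    the quotient by [t], which is therefore trivial. *)
Lemma semidegenerate_total (sg : signature) (V : set (algebra sg))
    (A : algebra sg) (t : congruence A) (d : A) :
  variety V -> semidegenerate V -> V A ->
  (forall o : symbol sg, t (opn (fun _ : 'I_(arity o) => d)) d) ->
  forall x y, t x y.
Proof.
move=> [Vh _ _] Vs VA td x y; apply: contrapT => ntxy.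
have VQ : V (quotient t) by apply: Vh VA; exact: quo_hom_surj.
apply: (Vs _ VQ).
  by exists (quo_class t x), (quo_class t y) => /quo_classE.
exists (quo_class t d) => o xs xsd.
have -> : xs = (fun=> quo_class t d) by apply/funext.
apply: (etrans (esym (quo_class_opn t (fun=> d)))); exact/quo_classE.
Qed.

(** * A congruence as a subalgebra of the square *)

Section Square.
Context (sg : signature) (A : algebra sg) (a : congruence A).

Definition pairs : set (prod_algebra (fun _ : bool => A)) :=
  [set h | a (h true) (h false)].

Lemma pairs_sub : subuniverse pairs.
Proof. by move=> o xs h; exact: con_opn. Qed.

Lemma pairs_ex : exists h, pairs h.
Proof. by case: (carrier_inh A) => x; exists (fun=> x); exact: con_refl. Qed.

Definition square : algebra sg := subalgebra pairs_sub pairs_ex.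

Definition pr1 : hom square A :=
  @Hom sg square A (fun p => proj1_sig p true) (fun _ _ => erefl).

Definition pr2 : hom square A :=
  @Hom sg square A (fun p => proj1_sig p false) (fun _ _ => erefl).

Lemma square_rel (p : square) : a (pr1 p) (pr2 p).
Proof. exact: proj2_sig p. Qed.

Lemma square_ext (p q : square) : pr1 p = pr1 q -> pr2 p = pr2 q -> p = q.
Proof.
by case: p q => [p hp] [q hq] /= e1 e2; apply/eq_exist/funext => -[].
Qed.

Definition sq (x y : A) (axy : a x y) : square :=
  exist _ (fun b : bool => if b then x else y) axy.

Lemma diag_opn (o : symbol sg) (xs : 'I_(arity o) -> A) :
  sq (con_refl a (opn xs)) = opn (fun i => sq (con_refl a (xs i))).
Proof. exact: square_ext. Qed.

Definition diag : hom A square :=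
  @Hom sg A square (fun x => sq (con_refl a x)) diag_opn.

Definition swap_fun (p : square) : square := sq (con_sym (square_rel p)).

Lemma swap_opn (o : symbol sg) (ps : 'I_(arity o) -> square) :
  swap_fun (opn ps) = opn (fun i => swap_fun (ps i)).
Proof. exact: square_ext. Qed.

Definition swap : hom square square := Hom swap_opn.

Lemma pr2_surj : surj_hom pr2.
Proof. by move=> x; exists (diag x). Qed.

Lemma square_variety (V : set (algebra sg)) : variety V -> V A -> V square.
Proof. by move=> [_ Vsub Vprod] VA; apply: Vsub; exact: Vprod. Qed.

End Square.

Arguments diag {sg A} a.
Arguments pr1 {sg A} a.
Arguments pr2 {sg A} a.

Section SquareHom.
Context (sg : signature) (A B : algebra sg) (f : hom A B) (b : congruence B).

Definition square_fun (p : square (cpreim f b)) : square b :=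
  @sq sg B b (f (pr1 _ p)) (f (pr2 _ p)) (square_rel p).

Lemma square_fun_opn (o : symbol sg)
    (ps : 'I_(arity o) -> square (cpreim f b)) :
  square_fun (opn ps) = opn (fun i => square_fun (ps i)).
Proof. by apply: square_ext => /=; rewrite hom_opn. Qed.

Definition square_hom : hom (square (cpreim f b)) (square b) :=
  Hom square_fun_opn.

Lemma square_hom_surj : surj_hom f -> surj_hom square_hom.
Proof.
move=> fs q; have [x fx] := fs (pr1 b q); have [y fy] := fs (pr2 b q).
have bxy : cpreim f b x y by rewrite /= fx fy; exact: square_rel.
by exists (sq bxy); apply: square_ext.
Qed.

End SquareHom.

(** * The commutator through the diagonal congruence *)

Section Diagonal.
Context (sg : signature) (A : algebra sg).
Implicit Types (a b d : congruence A).

(** The congruence usually written with a capital delta, on the subalgebra [a]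
    of the square. *)
Definition diagc a b : congruence (square a) :=
  cgen (fun p q => exists x y, [/\ b x y, p = diag a x & q = diag a y]).

Lemma diagc_le a b (t : congruence (square a)) :
  b <=c cpreim (diag a) t -> diagc a b <=c t.
Proof. by move=> bt; apply: cgen_le => _ _ [x [y [bxy -> ->]]]; exact: bt. Qed.

Lemma diagc_diag a b x y : b x y -> diagc a b (diag a x) (diag a y).
Proof. by move=> bxy; apply: cgen_sub; exists x, y. Qed.

Lemma diagc_pr1 a b p q : diagc a b p q -> b (pr1 a p) (pr1 a q).
Proof. by move: p q; apply: (diagc_le (t := cpreim (pr1 a) b)) => x y. Qed.

Lemma diagc_pr2 a b p q : diagc a b p q -> b (pr2 a p) (pr2 a q).
Proof. by move: p q; apply: (diagc_le (t := cpreim (pr2 a) b)) => x y. Qed.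

Lemma diagc_swap a b p q : diagc a b p q -> diagc a b (swap a p) (swap a q).
Proof.
move: p q; apply: (diagc_le (t := cpreim (swap a) (diagc a b))) => x y bxy /=.
have e z : swap_fun (diag a z) = diag a z by exact: square_ext.
by rewrite !e; exact: diagc_diag.
Qed.

(** Unlike the term condition, this is visibly stable under enlarging [d]; the
    two forms of the term condition are recovered from it by shifting, in
    [tcomm_transfer_rows] and [tcomm_transfer_cols]. *)
Definition centralizes a b d : Prop :=
  forall p q, diagc a b p q -> pr1 a p = pr1 a q -> d (pr2 a p) (pr2 a q).

Definition tcomm a b : congruence A := cInf [set d | centralizes a b d].

Lemma tcomm_leP a b d : tcomm a b <=c d <-> centralizes a b d.
Proof.
split=> [le p q Dpq e|h x y]; last by apply.
by apply: le => t; apply.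
Qed.

Lemma tcomm_lel a b : tcomm a b <=c a.
Proof.
apply/tcomm_leP => p q _ e; apply: con_trans (square_rel q).
by rewrite -e; apply: con_sym; exact: square_rel.
Qed.

Lemma tcomm_ler a b : tcomm a b <=c b.
Proof. by apply/tcomm_leP => p q /diagc_pr2. Qed.

Lemma tcomm_monor a b b' : b <=c b' -> tcomm a b <=c tcomm a b'.
Proof.
move=> bb; apply/tcomm_leP => p q Dpq.
have /tcomm_leP h := @cle_refl _ _ (tcomm a b'); apply: h.
by move: Dpq; apply: diagc_le => x y /bb; exact: diagc_diag.
Qed.

End Diagonal.

Section Modular.
Context (sg : signature) (V : set (algebra sg)).
Hypotheses (V_variety : variety V) (V_modular : congruence_modular V).

Section Centrality.
Context (A : algebra sg) (VA : V A).
Implicit Types (a b d : congruence A).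

Let VS a : V (square a).
Proof. exact: square_variety. Qed.

(** The shifted rectangle has the corners [diag (pr1 p)], [p], [q] and
    [diag (pr1 q)], with the diagonal pair as its known side. *)
Lemma tcomm_transfer_rows a b d p q :
  tcomm a b <=c d -> diagc a b p q ->
  d (pr1 a p) (pr1 a q) -> d (pr2 a p) (pr2 a q).
Proof.
move=> /tcomm_leP cd Dpq d1.
apply: (@shifting _ _ _ (diagc a b) (cker (pr1 a)) (cpreim (pr2 a) d)
          (diag a (pr1 a p)) p (diag a (pr1 a q)) q V_modular (VS a)) => //.
- move=> u v uv; apply: cd; first exact: cmeet_lel uv.
  exact: (cmeet_ler uv).
- by apply: diagc_diag; exact: diagc_pr1 Dpq.
Qed.

(** The same rectangle, with the side from [diag (pr1 p)] to [p] as its known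
    one. *)
Lemma tcomm_transfer_cols a b d p q :
  tcomm a b <=c d -> diagc a b p q ->
  d (pr1 a p) (pr2 a p) -> d (pr1 a q) (pr2 a q).
Proof.
move=> /tcomm_leP cd Dpq d1.
apply: (@shifting _ _ _ (cker (pr1 a)) (diagc a b) (cpreim (pr2 a) d)
          (diag a (pr1 a p)) (diag a (pr1 a q)) p q V_modular (VS a)) => //.
- move=> u v uv; apply: cd; first exact: cmeet_ler uv.
  exact: (cmeet_lel uv).
- by apply: diagc_diag; exact: diagc_pr1 Dpq.
Qed.

(** Centrality need only be tested against diagonal pairs: a vertical pair can
    be shifted along the second projection until its first entry lies on the
    diagonal. *)
Lemma tcomm_le_diag a b d :
  (forall q, diagc a b (diag a (pr1 a q)) q -> d (pr1 a q) (pr2 a q)) ->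
  tcomm a b <=c d.
Proof.
move=> h; apply/tcomm_leP => p q Dpq e.
have ayz : a (pr2 a p) (pr2 a q).
  apply: con_trans (square_rel q); rewrite -e.
  by apply: con_sym; exact: square_rel.
apply: (h (sq ayz)).
apply: (@shifting _ _ _ (cker (pr1 a)) (cker (pr2 a)) (diagc a b)
          p (diag a (pr2 a p)) q (sq ayz) V_modular (VS a)) => //.
move=> u v uv; rewrite (square_ext (cmeet_lel uv) (cmeet_ler uv)).
exact: con_refl.
Qed.

(** Transposing the two-by-two matrices that connect pairs by [diagc a b]
    yields a relation on the square of [b] containing the generators of
    [diagc b a]; each of its steps preserves membership in [tcomm a b]. *)
Lemma tcomm_sym_le a b : tcomm b a <=c tcomm a b.
Proof.
set d := tcomm a b.
pose R (p q : square b) := exists u v : square a,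
  [/\ diagc a b u v, pr1 a u = pr1 b p & pr2 a u = pr1 b q] /\
  (pr1 a v = pr2 b p /\ pr2 a v = pr2 b q).
have Rrefl p : R p p.
  exists (diag a (pr1 b p)), (diag a (pr2 b p)); split=> //; split=> //.
  by apply: diagc_diag; exact: square_rel.
have Rsym p q : R p q -> R q p.
  move=> [u [v [[Duv u1 u2] [v1 v2]]]].
  by exists (swap a u), (swap a v); split=> //; split=> //; exact: diagc_swap.
have Rtr : translation_stable R.
  move=> o xs ys k e Rk.
  have Ri i : R (xs i) (ys i).
    by case: (eqVneq i k) => [->//|/e ->]; exact: Rrefl.
  have [us hu] := choice Ri; have [vs hv] := choice hu.
  exists (opn us), (opn vs); split; [split|split].
  - by apply: con_opn => i; case: (hv i) => -[].
  - by rewrite !hom_opn; congr opn; apply/funext => i; case: (hv i) => -[].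
  - by rewrite !hom_opn; congr opn; apply/funext => i; case: (hv i) => -[].
  - by rewrite !hom_opn; congr opn; apply/funext => i; case: (hv i) => _ [].
  - by rewrite !hom_opn; congr opn; apply/funext => i; case: (hv i) => _ [].
apply: tcomm_le_diag => q Dq.
have {Dq} : cgen R (diag b (pr1 b q)) q.
  move: Dq; apply: diagc_le => x y axy; apply: cgen_sub.
  exists (sq axy), (sq axy); split=> //; split=> //; exact: con_refl.
move/(cgen_ind Rsym Rtr (P := fun p => d (pr1 b p) (pr2 b p))).
apply; last exact: con_refl.
move=> p r [u [v [[Duv <- <-] [<- <-]]]].
exact: tcomm_transfer_rows Duv.
Qed.

Lemma tcomm_sym a b : tcomm a b = tcomm b a.
Proof. by apply: con_ext; exact: tcomm_sym_le. Qed.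

(** The diagonal congruence of a join is the join of the diagonal congruences,
    and each of these preserves membership of a pair in [d]. *)
Lemma tcomm_Sup_le a (S : set (congruence A)) d :
  (forall b, S b -> tcomm a b <=c d) -> tcomm a (cSup S) <=c d.
Proof.
move=> Sd; pose R p q := exists2 b, S b & diagc a b p q.
apply: tcomm_le_diag => q Dq.
have {Dq} : cgen R (diag a (pr1 a q)) q.
  move: Dq; apply: diagc_le; apply: cSup_lub => b Sb x y bxy.
  by apply: cgen_sub; exists b => //; exact: diagc_diag.
have Rsym p r : R p r -> R r p.
  by move=> [b Sb Dpr]; exists b => //; exact: con_sym.
have Rtr : translation_stable R.
  move=> o xs ys k e [b Sb Dk]; exists b => //; apply: con_opn => i.
  by case: (eqVneq i k) => [->//|/e ->]; exact: con_refl.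
move/(cgen_ind Rsym Rtr (P := fun p => d (pr1 a p) (pr2 a p))).
apply; last exact: con_refl.
move=> p r [b /Sd bd Dpr]; exact: tcomm_transfer_cols bd Dpr.
Qed.

Lemma tcomm_join_le a b b' d :
  tcomm a b <=c d -> tcomm a b' <=c d -> tcomm a (cjoin b b') <=c d.
Proof. by move=> h h'; apply: tcomm_Sup_le => _ [->|->]. Qed.

End Centrality.

(** For the inclusion from left to right, lift a relation between pairs with
    equal first entries along [square_hom f a].  By modularity the lifted
    relation is a join of one inside the kernel of [square_hom f a] and one
    inside [diagc] whose first entries are identified by [f]; both only relate
    pairs whose second entries are congruent modulo [d]. *)
Lemma tcomm_preim (A B : algebra sg) (f : hom A B) (fs : surj_hom f)
    (a b : congruence B) : V A ->
  cpreim f (tcomm a b) =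
  cjoin (tcomm (cpreim f a) (cpreim f b)) (cker f).
Proof.
move=> VA; set a' := cpreim f a; set b' := cpreim f b.
set d := cjoin _ _; pose g := square_hom f a.
have kd : cker f <=c d by exact: cjoin_ler.
have td : tcomm a' b' <=c d by exact: cjoin_lel.
apply: con_ext; last first.
  apply: cjoin_lub; last exact: cker_preim.
  apply/tcomm_leP => p q Dpq e.
  have /tcomm_leP h := @cle_refl _ _ (tcomm a b).
  apply: (h (g p) (g q)); last exact: (congr1 f e).
  move: p q Dpq {e}; apply: (diagc_le (t := cpreim g (diagc a b))) => x y bxy.
  have e z : g (diag a' z) = diag a (f z) by exact: square_ext.
  rewrite -[cpreim _ _ _ _]/(diagc a b (g (diag a' x)) (g (diag a' y))) !e.
  exact: diagc_diag.
rewrite -[d](cpreim_image fs kd); apply: cpreim_le.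
apply/tcomm_leP => p' q' Dpq' e'.
pose E := cjoin (cker g) (diagc a' b').
have kE : cker g <=c E by exact: cjoin_lel.
have gs : surj_hom g by exact: square_hom_surj.
have [p [q [Epq gp gq]]] : cimage gs kE p' q'.
  move: p' q' Dpq' {e'}; apply: diagc_le => u v buv.
  have [x fx] := fs u; have [y fy] := fs v.
  exists (diag a' x), (diag a' y); split.
  - by apply: cjoin_ler; apply: diagc_diag; rewrite /b' /= fx fy.
  - exact: square_ext.
  - exact: square_ext.
pose K := cpreim (pr1 a') (cker f).
have gK : cker g <=c K by move=> u v /(congr1 (pr1 a)).
have := V_modular (square_variety a' V_variety VA) (diagc a' b') gK.
rewrite -/E => modE.
exists (pr2 a' p), (pr2 a' q); split; [|by rewrite -gp|by rewrite -gq].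
have : cmeet E K p q.
  by move=> _ [->|->] //; move: e'; rewrite -gp -gq.
rewrite -modE => h; apply: (h (cpreim (pr2 a') d)) => _ [->|->].
  by move=> u v /(congr1 (pr2 a)) uv; apply: kd.
move=> u v uv; apply: tcomm_transfer_rows td (cmeet_lel uv) _ => //.
exact/kd/(cmeet_ler uv).
Qed.

Lemma tcomm_axioms : commutator_axioms V (@tcomm sg).
Proof.
split=> [A VA a b|A B f fs VA VB a b].
  by apply: cle_meet; [exact: tcomm_lel|exact: tcomm_ler].
rewrite tcomm_preim // !cpreim_image.
set k := cker f; set a' := cjoin a k; set b' := cjoin b k.
have monol c c' : c <=c c' -> tcomm c b <=c tcomm c' b.
  by move=> cc; rewrite !(tcomm_sym VA _ b); exact: tcomm_monor.
apply: con_ext; apply: cjoin_lub; try exact: cjoin_ler.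
  apply: cle_trans (@cjoin_lel _ _ _ _); apply: (cle_trans (tcomm a' b)).
    by apply: monol; exact: cjoin_lel.
  by apply: tcomm_monor; exact: cjoin_lel.
have kJ c : tcomm c k <=c cjoin (tcomm a b) k.
  by apply: cle_trans (@cjoin_ler _ _ _ _); exact: tcomm_ler.
apply: tcomm_join_le => //; rewrite tcomm_sym //.
by apply: tcomm_join_le => //; rewrite tcomm_sym //; exact: cjoin_lel.
Qed.

(** The bound from above only needs the axioms: in the square of [a], the
    commutator of the kernel of the first projection with [diagc a b] lies in
    their meet, and the second projection maps these two congruences to [a] and
    [b]. *)
Lemma commutator_tcomm (C : con_operation sg) (A : algebra sg)
    (a b : congruence A) :
  is_commutator V C -> V A -> C A a b = tcomm a b.
Proof.
move=> [[C1 C2] Cmax] VA; apply: con_ext; last exact: (Cmax _ tcomm_axioms).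
have VS : V (square a) by exact: square_variety.
have := C2 _ _ (pr2 a) (@pr2_surj _ _ a) VS VA (cker (pr1 a)) (diagc a b).
have -> : cimage (@pr2_surj _ _ a)
    (@cjoin_ler _ _ (cker (pr1 a)) (cker (pr2 a))) = a.
  apply: (cpreim_inj (@pr2_surj _ _ a)); rewrite cpreim_image.
  apply: con_ext.
    apply: cjoin_lub; last exact: cker_preim.
    move=> p q /= e; apply: con_trans (square_rel q); rewrite /= -e.
    by apply: con_sym; exact: square_rel.
  move=> p q apq.
  have apq' : a (pr1 a p) (pr2 a q) := con_trans (square_rel p) apq.
  apply: (@con_trans _ _ _ _ (sq apq')).
    exact: cjoin_lel.
  exact: cjoin_ler.
have -> : cimage (@pr2_surj _ _ a)
    (@cjoin_ler _ _ (diagc a b) (cker (pr2 a))) = b.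
  apply: (cpreim_inj (@pr2_surj _ _ a)); rewrite cpreim_image.
  apply: con_ext.
    apply: cjoin_lub; last exact: cker_preim.
    by move=> p q; exact: diagc_pr2.
  move=> p q bpq.
  apply: (@con_trans _ _ _ _ (diag a (pr2 a p))); first exact: cjoin_ler.
  apply: (@con_trans _ _ _ _ (diag a (pr2 a q))); last exact: cjoin_ler.
  by apply: cjoin_lel; exact: diagc_diag.
move=> e x y Cxy.
have : cpreim (pr2 a) (C A a b) (diag a x) (diag a y) by [].
rewrite -e => h; apply: (h (cpreim (pr2 a) (tcomm a b))) => _ [->|->].
  move=> p q /(C1 _ VS) pq.
  have /tcomm_leP t := @cle_refl _ _ (tcomm a b).
  by apply: t (cmeet_ler pq) _; exact: (cmeet_lel pq).
exact: cker_preim.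
Qed.

(** The diagonal is a [diagc a nabla]-class and a subalgebra, hence a
    one-element subalgebra of the quotient, so that [diagc a nabla] is total. *)
Lemma tcomm_nabla (A : algebra sg) (a : congruence A) :
  semidegenerate V -> V A -> tcomm a (cnabla A) = a.
Proof.
move=> Vs VA; apply: con_ext; first exact: tcomm_lel.
move=> x y axy.
have /tcomm_leP t := @cle_refl _ _ (tcomm a (cnabla A)).
apply: (t (diag a x) (sq axy)) => //.
apply: (semidegenerate_total (V := V) (d := diag a x)) => //.
  exact: square_variety.
by move=> o; rewrite -(hom_opn (diag a) (fun=> x)); exact: diagc_diag.
Qed.

End Modular.

(** * Compact congruences *)

Section Compact.
Context (sg : signature) (A : algebra sg).
Implicit Types (a b s t : congruence A) (S F G : set (congruence A)).

Lemma cSup_mono F G : F `<=` G -> cSup F <=c cSup G.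
Proof. by move=> FG; apply: cSup_lub => s /FG; exact: cSup_ub. Qed.

(** The pairs lying in the join of some finite subset form a congruence above
    every member of [S]. *)
Lemma cSup_finite S x y : cSup S x y ->
  exists F, [/\ finite_set F, F `<=` S & cSup F x y].
Proof.
pose E u v := exists F, [/\ finite_set F, F `<=` S & cSup F u v].
have Er u : E u u.
  by exists set0; split; [|exact: sub0set|exact: con_refl].
have Es u v : E u v -> E v u.
  by move=> [F [fF FS Fuv]]; exists F; split=> //; exact: con_sym.
have Et u v w : E u v -> E v w -> E u w.
  move=> [F [fF FS Fuv]] [G [fG GS Gvw]]; exists (F `|` G); split.
  - by rewrite finite_setU.
  - by rewrite subUset.
  - by apply: (@con_trans _ _ _ _ v);
      [apply: cSup_mono Fuv; exact: subsetUl
      |apply: cSup_mono Gvw; exact: subsetUr].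
have Eo (o : symbol sg) (xs ys : 'I_(arity o) -> A) :
    (forall i, E (xs i) (ys i)) -> E (opn xs) (opn ys).
  move=> h; have [F hF] := choice h.
  exists (\bigcup_i F i); split.
  - by apply: bigcup_finite => [|i _]; [exact: finite_finset|case: (hF i)].
  - by move=> s [i _]; case: (hF i) => _ FS _; exact: FS.
  - apply: con_opn => i; case: (hF i) => _ _; apply: cSup_mono.
    exact: bigcup_sup.
move=> h; apply: (h (Congruence Er Es Et Eo)) => s Ss u v suv.
exists [set s]; split; [exact: finite_set1|by move=> _ ->|].
by apply: cSup_ub suv.
Qed.

Lemma KCon_principal (x y : A) : KCon (cprincipal x y).
Proof.
move=> S pS; have [F [fF FS Fxy]] := cSup_finite (pS _ _ (cprincipal_refl x y)).
by exists F => //; exact: cprincipal_le.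
Qed.

(** Collapsing an element [d] with all its values [o(d, ..., d)] makes its class
    a one-element subalgebra, so these finitely many pairs generate the greatest
    congruence. *)
Lemma KCon_nabla (V : set (algebra sg)) :
  variety V -> semidegenerate V -> V A -> KCon (cnabla A).
Proof.
move=> Vv Vs VA S top; have [d] := carrier_inh A.
have h (o : symbol sg) : exists F, [/\ finite_set F, F `<=` S &
    cSup F (opn (fun _ : 'I_(arity o) => d)) d] by exact/cSup_finite/top.
have [F hF] := choice h; exists (\bigcup_o F o).
  split; last by move=> s [o _]; case: (hF o) => _ FS _; exact: FS.
  by apply: bigcup_finite => [|o _]; [exact: finite_finset|case: (hF o)].
move=> x y _; apply: (semidegenerate_total (d := d) Vv Vs VA) => o.
by case: (hF o) => _ _; apply: cSup_mono; exact: bigcup_sup.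
Qed.

Lemma KCon_chain a F : KCon a -> F !=set0 -> total_on F (@cle sg A) ->
  a <=c cSup F -> exists2 t, F t & a <=c t.
Proof.
move=> Ka F0 Ftot /Ka [G [fG GF] aG].
suff [t Ft Gt] : exists2 t, F t & forall s, G s -> s <=c t.
  by exists t => //; apply: (cle_trans _ aG); exact: cSup_lub.
have /finite_seqP [l Gl] : finite_set (G : set {classic congruence A}) by [].
move: GF; rewrite Gl; elim: l {Gl fG aG} => [|b l IH] lF.
  by have [t Ft] := F0; exists t.
have [|t Ft lt] := IH.
  by move=> s sl; apply: lF; rewrite /= inE sl orbT.
have Fb : F b by apply: lF; rewrite /= inE eqxx.
have [tb|bt] := Ftot _ _ Ft Fb.
- exists b => // s; rewrite /= inE => /orP[/eqP-> //|sl].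
  by apply: cle_trans tb; exact: lt.
- by exists t => // s; rewrite /= inE => /orP[/eqP-> //|]; exact: lt.
Qed.

End Compact.

Arguments KCon_principal {sg A} x y.

Lemma Zorn_set (T : Type) (R : T -> T -> Prop) (P : set T) :
  (forall t, R t t) -> (forall r s t, R r s -> R s t -> R r t) ->
  (forall s t, R s t -> R t s -> s = t) ->
  (forall F : set T, F `<=` P -> total_on F R ->
     exists2 u, P u & forall s, F s -> R s u) ->
  exists2 m, P m & forall s, P s -> R m s -> s = m.
Proof.
move=> Rr Rt Ra ub.
pose R' (u v : {x | P x}) : bool := `[< R (proj1_sig u) (proj1_sig v) >].
have [||||[m Pm] mmax] := @Zorn _ R'.
- by move=> u; exact/asboolP.
- by move=> u v w /asboolP uv /asboolP vw; apply/asboolP; exact: Rt vw.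
- move=> [u Pu] [v Pv] /asboolP uv /asboolP vu.
  by apply: eq_exist; exact: Ra.
- move=> F Ftot.
  have [||u Pu uF] := ub [set x | exists2 s, F s & proj1_sig s = x].
  + by move=> _ [s _ <-]; exact: proj2_sig.
  + move=> _ _ [s Fs <-] [t Ft <-].
    by have [/asboolP|/asboolP] := Ftot _ _ Fs Ft; [left|right].
  + by exists (exist _ u Pu) => s Fs; apply/asboolP/uF; exists s.
- exists m => // s Ps ms.
  have /(_ _)/(congr1 (@proj1_sig _ _)) := mmax (exist _ s Ps).
  by apply; exact/asboolP.
Qed.

(** * Prime congruences *)

Section Primes.
Context (sg : signature) (C : con_operation sg) (A : algebra sg).
Implicit Types (a b c d p q s t : congruence A) (S : set (congruence A)).

Hypotheses (C_sym : forall a b, C a b = C b a)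
  (C_ler : forall a b, C a b <=c b)
  (C_monor : forall a b b', b <=c b' -> C a b <=c C a b')
  (C_Sup : forall a S d,
     (forall b, S b -> C a b <=c d) -> C a (cSup S) <=c d)
  (C_nabla : forall a, C a (cnabla A) = a)
  (C_compact : forall a b, KCon a -> KCon b -> KCon (C a b))
  (nabla_compact : KCon (cnabla A)).

Local Notation Spec := (@Spec sg C A).
Local Notation MinSpec := (@MinSpec sg C A).
Local Notation perp := (@cperp sg C A).

Lemma C_lel a b : C a b <=c a.
Proof. by rewrite C_sym. Qed.

Lemma C_mono a a' b b' : a <=c a' -> b <=c b' -> C a b <=c C a' b'.
Proof.
move=> aa bb; apply: (cle_trans (C a b')); first exact: C_monor.
by rewrite !(C_sym _ b'); exact: C_monor.
Qed.

Lemma C_join_le t a b d : C a b <=c d -> t <=c d ->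
  C (cjoin t a) (cjoin t b) <=c d.
Proof.
move=> abd td; apply: C_Sup => _ [->|->]; first by apply: cle_trans td.
rewrite C_sym; apply: C_Sup => _ [->|->]; first by apply: cle_trans td.
by rewrite C_sym.
Qed.

Lemma perp_max a b : C a b = cdelta A -> b <=c perp a.
Proof. by move=> h; apply: cSup_ub. Qed.

Lemma C_perp a : C a (perp a) = cdelta A.
Proof.
apply: con_ext; last exact: cle_delta.
by apply: C_Sup => b ->.
Qed.

Lemma prime_perp a p : Spec p -> ~ a <=c p -> perp a <=c p.
Proof.
move=> [_ pp] nap; have [|//|//] := pp a (perp a).
by rewrite C_perp; exact: cle_delta.
Qed.

Lemma cle_compact a b : (forall c, KCon c -> c <=c a -> c <=c b) -> a <=c b.
Proof.
move=> h x y axy.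
exact: (h _ (KCon_principal x y) (cprincipal_le axy) _ _ (cprincipal_refl x y)).
Qed.

Lemma semiprime_le a : semiprime C A -> (forall p, Spec p -> a <=c p) ->
  a = cdelta A.
Proof.
move=> sp h; apply: con_ext; last exact: cle_delta.
by rewrite -sp => x y axy p Sp; exact: h.
Qed.

(** A congruence maximal among those above [t] and above no member of [S] is
    prime; compactness of the members of [S] makes that property inductive. *)
Lemma prime_avoiding S t :
  S !=set0 -> (forall s, S s -> KCon s) ->
  (forall s s', S s -> S s' -> exists2 u, S u & u <=c C s s') ->
  (forall s, S s -> ~ s <=c t) ->
  exists p, [/\ Spec p, t <=c p & forall s, S s -> ~ s <=c p].
Proof.
move=> [s0 Ss0] SK Smul St.
pose P : set (congruence A) := [set q | t <=c q /\ forall s, S s -> ~ s <=c q].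
have [||||p [tp pS] pmax] := @Zorn_set _ (@cle sg A) P.
- exact: cle_refl.
- by move=> a b c; exact: cle_trans.
- by move=> a b; exact: con_ext.
- move=> F FP Ftot; have [->|/set0P F0] := eqVneq F set0.
    by exists t; [split|].
  exists (cSup F); last by move=> s; exact: cSup_ub.
  split.
    have [q Fq] := F0; apply: cle_trans (cSup_ub Fq).
    by case: (FP _ Fq).
  move=> s Ss /(KCon_chain (SK _ Ss) F0 Ftot) [q Fq].
  by case: (FP _ Fq) => _ /(_ _ Ss).
have above a : ~ a <=c p -> exists2 s, S s & s <=c cjoin p a.
  move=> nap; apply: contrapT => h; apply: nap.
  suff <- : cjoin p a = p by exact: cjoin_ler.
  apply: pmax; last exact: cjoin_lel.
  split; first by apply: cle_trans tp _; exact: cjoin_lel.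
  by move=> s Ss spa; apply: h; exists s.
exists p; split=> //; split=> [pT|a b abp].
  by apply: (pS _ Ss0); rewrite pT.
apply: contrapT => /not_orP [/above [s Ss sa] /above [s' Ss' sb]].
have [u Su us] := Smul _ _ Ss Ss'.
apply: (pS _ Su); apply: cle_trans us _; apply: cle_trans (C_mono sa sb) _.
exact: C_join_le.
Qed.

Lemma minimal_prime_below p : Spec p -> exists2 m, MinSpec m & m <=c p.
Proof.
move=> Sp; pose P : set (congruence A) := [set q | Spec q /\ q <=c p].
have [||||m [Sm mp] mmin] := @Zorn_set _ (fun a b => b <=c a) P.
- exact: cle_refl.
- by move=> a b c ab bc; exact: cle_trans ab.
- by move=> a b ab ba; exact: con_ext.
- move=> F FP Ftot; have [->|/set0P [q0 Fq0]] := eqVneq F set0.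
    by exists p => //; split=> //; exact: cle_refl.
  have Fle q : F q -> cInf F <=c q by move=> Fq x y h; exact: h.
  exists (cInf F) => //; split; last first.
    by apply: cle_trans (Fle _ Fq0) _; case: (FP _ Fq0).
  split=> [e|a b abF].
    case: (FP _ Fq0) => -[+ _] _; apply; apply: con_ext => //.
    by rewrite -e; exact: Fle.
  apply: contrapT => /not_orP.
  move=> [/cleNP [x [y [axy nF]]] /cleNP [u [v [buv nF']]]].
  apply: nF => q Fq; apply: contrapT => nq; apply: nF' => r Fr.
  apply: contrapT => nr.
  have side s : F s -> a <=c s \/ b <=c s.
    move=> Fs; case: (FP _ Fs) => -[_ h] _; apply: h.
    exact: cle_trans abF (Fle _ Fs).
  have [qr|rq] := Ftot _ _ Fq Fr.
  - by have [h|h] := side _ Fr; [apply: nq; exact/qr/h|exact/nr/h].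
  - by have [h|h] := side _ Fq; [exact/nq/h|apply: nr; exact/rq/h].
exists m => //; split=> // q Sq qm.
by apply: mmin => //; split=> //; exact: cle_trans qm mp.
Qed.

(** The commutator need not be associative, so one cannot
    localize at [p] by products [x a^n].  Instead, call [s] admissible if it is
    controlled by [a] and some [c] not below [p]: every prime above [s] is above
    [a] or above [c].  Admissible congruences are closed under the commutator
    and include [a] and everything not below [p].  A prime above no admissible
    compact congruence would lie below [p] and not contain [a], so zero is
    admissible, which for a semiprime algebra says that some [c] not below [p]
    satisfies [C a c = 0]. *)
Lemma perp_not_below a p :
  semiprime C A -> KCon a -> Spec p ->
  (forall q, Spec q -> q <=c p -> a <=c q) -> ~ perp a <=c p.
Proof.
move=> sp Ka Sp ap perp_p.
pose S : set (congruence A) := [set s | KCon s /\ exists2 c, ~ c <=c p &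
  forall q, Spec q -> s <=c q -> a <=c q \/ c <=c q].
have SK s : KCon s -> ~ s <=c p -> S s.
  by move=> Ks ns; split=> //; exists s => // q _ sq; right.
have Sa : S a.
  split=> //; exists (cnabla A); last by move=> q _; left.
  by move=> h; case: Sp => + _; apply; exact: con_ext.
have [||||q [Sq _ qS]] := @prime_avoiding S (cdelta A).
- by exists a.
- by move=> s [].
- move=> s s' [Ks [c nc hc]] [Ks' [c' nc' hc']]; exists (C s s') => //.
  split; first exact: C_compact.
  exists (C c c'); first by case: (Sp) => _ h /h [].
  move=> q Sq ssq; have [sq|sq] := Sq.2 _ _ ssq.
  + have [aq|cq] := hc _ Sq sq; first by left.
    by right; apply: cle_trans cq; exact: C_lel.
  + have [aq|cq] := hc' _ Sq sq; first by left.
    by right; apply: cle_trans cq; exact: C_ler.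
- move=> s [_ [c nc hc]] s0; apply: nc; apply: cle_trans perp_p.
  apply: perp_max; apply: semiprime_le => // q Sq.
  have [|aq|cq] := hc _ Sq; first by apply: cle_trans s0 _; exact: cle_delta.
  + by apply: cle_trans aq; exact: C_lel.
  + by apply: cle_trans cq; exact: C_ler.
apply: (qS _ Sa); apply: ap => //.
apply: cle_compact => c Kc cq; apply: contrapT => ncp.
exact: (qS _ (SK _ Kc ncp)).
Qed.

Lemma prime_above t : t <> cnabla A -> exists2 p, Spec p & t <=c p.
Proof.
move=> nt; have [||||p [Sp tp _]] := @prime_avoiding [set cnabla A] t.
- by exists (cnabla A).
- by move=> _ ->.
- by move=> _ _ -> ->; exists (cnabla A) => //; rewrite C_nabla.
- by move=> _ -> h; apply: nt; exact: con_ext.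
- by exists p.
Qed.

Lemma PF_comaximal a b : PF_algebra C A -> PCon a -> KCon b ->
  C a b = cdelta A -> cjoin (perp a) (perp b) = cnabla A.
Proof. by move=> PF Pa Kb ab; apply: PF => //; exact: perp_max. Qed.

Lemma PF_reduced b : PF_algebra C A -> C b b = cdelta A -> b = cdelta A.
Proof.
move=> PF bb; apply: con_ext; last exact: cle_delta.
move=> x y bxy; set a := cprincipal x y.
have aa : C a a = cdelta A.
  apply: con_ext; last exact: cle_delta.
  by rewrite -bb; apply: C_mono; exact: cprincipal_le.
have Pa : PCon a by exists x, y.
have := PF_comaximal PF Pa (KCon_principal x y) aa.
rewrite cjoin_idr // => e.
by rewrite -(C_perp a) e C_nabla; exact: cprincipal_refl.
Qed.

(** If the iterated squares of [a] never vanish, some prime avoids them all;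
    otherwise the last non-zero one squares to zero. *)
Lemma PF_semiprime : PF_algebra C A -> semiprime C A.
Proof.
move=> PF; apply: con_ext; last exact: cle_delta.
move=> x y xyS; set a := cprincipal x y.
pose pow n := iter n (fun b => C b b) a.
have pow_le m n : (m <= n)%N -> pow n <=c pow m.
  move=> /subnK <-; elim: (n - m)%N => [|k IH]; first exact: cle_refl.
  by apply: cle_trans IH; exact: C_ler.
have pow_K n : KCon (pow n).
  by elim: n => [|n IH]; [exact: KCon_principal|exact: C_compact].
have [n] : exists n, pow n = cdelta A; last first.
  elim: n => [e|n IH]; last by move/(PF_reduced PF).
  by rewrite -e; exact: cprincipal_refl.
apply: contrapT => pow0.
have [||||p [Sp _ pS]] :=
  @prime_avoiding [set b | exists n, b = pow n] (cdelta A).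
- by exists a, 0%N.
- by move=> _ [n ->].
- move=> _ _ [m ->] [n ->]; exists (pow (maxn m n).+1); first by eexists.
  by apply: C_mono; apply: pow_le; rewrite ?leq_maxl ?leq_maxr.
- move=> _ [n ->] h; apply: pow0; exists n; apply: con_ext => //.
  exact: cle_delta.
by apply: (pS a); [exists 0%N|apply: cprincipal_le; exact: xyS].
Qed.

(** Some principal [a] lies below the minimal prime [m] but not below [n].  Its
    annihilator is not below [m], so it has a compact part [c] outside [m], and
    the comaximal annihilators of [a] and [c] lie below [n] and [m]. *)
Lemma PF_minimal_le m n p : PF_algebra C A ->
  MinSpec m -> Spec n -> Spec p -> m <=c p -> n <=c p -> m <=c n.
Proof.
move=> PF [Sm mmin] Sn [pT _] mp np.
apply: contrapT => /cleNP [x [y [mxy nxy]]].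
pose a := cprincipal x y.
have am : a <=c m by exact: cprincipal_le.
have nan : ~ a <=c n by move=> /(_ x y (cprincipal_refl x y)).
have nperp : ~ perp a <=c m.
  apply: perp_not_below => //.
  - exact: PF_semiprime.
  - exact: KCon_principal.
  - by move=> q Sq /(mmin _ Sq) ->.
have [u [v [puv muv]]] := cleNP nperp; pose c := cprincipal u v.
have ac : C a c = cdelta A.
  apply: con_ext; last exact: cle_delta.
  by rewrite -(C_perp a); apply: C_monor; exact: cprincipal_le.
apply: pT; apply: con_ext => //.
rewrite -(PF_comaximal PF _ (KCon_principal u v) ac); last by exists x, y.
apply: cjoin_lub; first by apply: cle_trans np; exact: prime_perp.
apply: cle_trans mp; apply: prime_perp => //.
by move=> /(_ u v (cprincipal_refl u v)).
Qed.

Lemma PF_mp : PF_algebra C A -> mp_algebra C A.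
Proof.
move=> PF p Sp; have [m Mm mp] := minimal_prime_below Sp.
exists m; split=> // n [Mn np]; apply: con_ext.
- by apply: PF_minimal_le mp np; rewrite //; case: Mn.
- by apply: PF_minimal_le np mp; rewrite //; case: Mm.
Qed.

(** If the sum of the annihilators were proper, it would lie below a prime [p].
    The minimal prime inside [p] contains [a] or [b], and with it so does every
    prime below [p]; by [perp_not_below] the corresponding annihilator cannot
    lie below [p]. *)
Lemma semiprime_mp_PF : semiprime C A -> mp_algebra C A -> PF_algebra C A.
Proof.
move=> sp mp _ [x [y ->]] b Kb; set a := cprincipal x y => ba.
apply: contrapT => /prime_above [p Sp pp].
have [m [[Mm mle] muniq]] := mp p Sp.
have below q : Spec q -> q <=c p -> m <=c q.
  move=> Sq qp; have [m' Mm' m'q] := minimal_prime_below Sq.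
  by rewrite (muniq m') //; split=> //; exact: cle_trans m'q qp.
have [|am|bm] := Mm.1.2 a b.
- apply: (cle_trans (cdelta A)); last exact: cle_delta.
  by rewrite -(C_perp a); exact: C_monor.
- apply: (perp_not_below sp (KCon_principal x y) Sp).
    by move=> q Sq qp; apply: cle_trans am _; exact: below.
  by apply: cle_trans pp; exact: cjoin_lel.
- apply: (perp_not_below sp Kb Sp).
    by move=> q Sq qp; apply: cle_trans bm _; exact: below.
  by apply: cle_trans pp; exact: cjoin_ler.
Qed.

End Primes.

Theorem theorem9p22 (sg : signature) (V : set (algebra sg))
  (V_variety : variety V)
  (V_modular : congruence_modular V)
  (V_semidegenerate : semidegenerate V)
  (C : con_operation sg) (C_commutator : is_commutator V C)
  (A : algebra sg) (VA : V A)
  (KA : forall a b : congruence A, KCon a -> KCon b -> KCon (C A a b)) :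
  PF_algebra C A <-> semiprime C A /\ mp_algebra C A.
Proof.
have CT a b : C A a b = tcomm a b.
  exact: (commutator_tcomm V_variety V_modular).
have C_sym a b : C A a b = C A b a.
  by rewrite !CT; exact: (tcomm_sym V_variety V_modular VA).
have C_ler a b : C A a b <=c b by rewrite CT; exact: tcomm_ler.
have C_monor (a b b' : congruence A) : b <=c b' -> C A a b <=c C A a b'.
  by rewrite !CT; exact: tcomm_monor.
have C_Sup a (S : set (congruence A)) d :
    (forall b, S b -> C A a b <=c d) -> C A a (cSup S) <=c d.
  move=> h; rewrite CT; apply: (tcomm_Sup_le V_variety V_modular VA) => b Sb.
  by rewrite -CT; exact: h.
have C_nabla a : C A a (cnabla A) = a.
  by rewrite CT; exact: (tcomm_nabla V_variety).
have KT : KCon (cnabla A) by exact: (KCon_nabla V_variety).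
split=> [PF|[sp mp]]; last exact: semiprime_mp_PF.
by split; [exact: PF_semiprime|exact: PF_mp].
Qed.
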